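(* Let $\theta^*$ be the solution of the QCELS minimization problem with parameters $N,N_s,\tau$ (see context), let $T=N\tau$, and assume $p_0>0.71$. Let $0<\delta\le 4$ (depth constant), $0<\eta<1/2$ (failure probability), $\epsilon>0$ and let $\zeta>0$ be small. If $\delta=\Theta(\sqrt{1-p_0})$ and $$NN_s=\Omega\left(\delta^{-(2+\zeta)}\,\mathrm{polylog}\left(\log(\zeta^{-1})\eta^{-1}\right)\right),\qquad \min\{N,N_s\}=\Omega(\mathrm{polylog}(\eta^{-1})),\qquad T=\frac{\delta}{\epsilon},$$ then $$\mathbb{P}\left(\left|(\theta^*-\lambda_0)\ \mathrm{mod}\ [-\pi/\tau,\pi/\tau)\right|<\frac{\delta}{T}\right)\ge 1-\eta .$$
   Context: Setting. $H$ is a Hermitian operator on a finite-dimensional complex Hilbert space with an orthonormal eigenbasis $|\psi_m\rangle$, $0\le m\le M-1$, and eigenvalues $\lambda_m\in\mathbb{R}$; $\lambda_0$ (not necessarily the smallest) is the target eigenvalue and $\lambda_0\in[-\pi,\pi)$. $|\psi\rangle$ is a unit vector and $p_m=|\langle\psi_m|\psi\rangle|^2$. Given integers $N,N_s\ge1$ and $\tau>0$, let $X_{k,n},Y_{k,n}$ ($1\le k\le N_s$, $0\le n\le N-1$) be independent $\{\pm1\}$-valued random variables with $\mathbb{E}X_{k,n}=\mathrm{Re}\langle\psi|e^{-in\tau H}|\psi\rangle$ and $\mathbb{E}Y_{k,n}=\mathrm{Im}\langle\psi|e^{-in\tau H}|\psi\rangle$ (Hadamard-test measurement outcomes), and let $Z_n=\frac1{N_s}\sum_{k=1}^{N_s}(X_{k,n}+iY_{k,n})$.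 QCELS: $(r^*,\theta^* )$ is a minimizer over $r\in\mathbb{C},\theta\in\mathbb{R}$ of $L(r,\theta)=\frac1N\sum_{n=0}^{N-1}|Z_n-r e^{-i\theta n\tau}|^2$. Notation: $x\ \mathrm{mod}\ [-a,a)$ is the representative in $[-a,a)$ of $x$ modulo $2a$. Asymptotic convention: the assertion is that there are suitable constants (those implicit in $\Omega$, $\Theta$, in ''small'', and the exponent in $\mathrm{polylog}$), depending on nothing except possibly $\zeta$, for which it holds for all remaining parameters. A hypothesis $A=\Omega(B)$ means $A\ge CB$ with $C$ large enough; $\delta=\Theta(\sqrt{1-p_0})$ means $c_1\sqrt{1-p_0}\le\delta\le c_2\sqrt{1-p_0}$ with $c_1$ suitably large and $c_2\ge c_1$ (the other constants may depend on $c_2$); $\mathrm{polylog}(x_1x_2\cdots)$ denotes a fixed power of $2+\sum_i|\log x_i|$. *)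

(* Defs.v *)
From mathcomp Require Import all_boot all_order all_algebra.
From mathcomp Require Import all_classical all_reals all_analysis.
From mathcomp Require Import complex.

Set Implicit Arguments.
Unset Strict Implicit.
Unset Printing Implicit Defensive.

Import Order.TTheory GRing.Theory Num.Theory.
Import numFieldNormedType.Exports Normc.

Local Open Scope classical_set_scope.
Local Open Scope complex_scope.
Local Open Scope ring_scope.
Local Open Scope sesquilinear_scope.

(* exp(i x) for real x. *)
Definition cis (R : realType) (x : R) : R[i] := cos x +i* sin x.

(* Convergence is that of the (entrywise) matrix topology. *)
Definition expmx (K : numFieldType) (n : nat) (A : 'M[K]_n) : 'M[K]_n :=
  limn (series (fun k => (k`!%:R)^-1 *: A ^+ k)).

(* Antilinear in the first argument, as in Dirac notation. *)
Definition braket (R : realType) (n : nat) (u v : 'cV[R[i]]_n) : R[i] :=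
  (u ^t* *m v) ord0 ord0.

Definition orthonormal_family (R : realType) (n : nat) (I : finType)
    (u : I -> 'cV[R[i]]_n) : Prop :=
  forall a b, braket (u a) (u b) = (a == b)%:R.

(* <psi| exp(- i t H) |psi> *)
Definition signal (R : realType) (n : nat) (H : 'M[R[i]]_n) (psi : 'cV[R[i]]_n)
    (t : R) : R[i] :=
  braket psi (expmx ((0 -i* t) *: H) *m psi).

(* The representative in [-a, a) of x modulo 2a, for 0 < a: the floor of
   (x + a) / (2a) is the integer k with x - 2 a k in [-a, a). *)
Definition modsym (R : realType) (a x : R) : R :=
  x - (2 * a) * (Num.floor ((x + a) / (2 * a)))%:~R.

(* polylog(x_1 x_2 ...) is a fixed power of 2 + sum_i |log x_i|. *)
Definition polylog (R : realType) (k : nat) (xs : seq R) : R :=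
  (2 + \sum_(x <- xs) `|ln x|) ^+ k.

Definition mutually_independent d (T : measurableType d) (R : realType)
    (P : probability T R) (I : finType) (W : I -> {RV P >-> R}) : Prop :=
  forall (J : {set I}) (B : I -> set R),
    (forall j, j \in J -> measurable (B j)) ->
    P (\bigcap_(j in [set` J]) (W j @^-1` B j)) =
    (\prod_(j in J) P (W j @^-1` B j))%E.

(* The averages Z_n; indices k run from 0 instead of 1. *)
Definition hadamard_average (R : realType) (Omega : Type) (N Ns : nat)
    (X Y : 'I_Ns -> 'I_N -> Omega -> R) (w : Omega) (n : 'I_N) : R[i] :=
  Ns%:R^-1 * \sum_(k < Ns) (X k n w +i* Y k n w).

Definition qcels_loss (R : realType) (N : nat) (tau : R) (z : 'I_N -> R[i])
    (r : R[i]) (theta : R) : R :=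
  N%:R^-1 * \sum_(n < N) normc (z n - r * cis (- (theta * n%:R * tau))) ^+ 2.

Definition qcels_minimizer (R : realType) (N : nat) (tau : R)
    (z : 'I_N -> R[i]) (r0 : R[i]) (theta0 : R) : Prop :=
  forall (r : R[i]) (theta : R),
    qcels_loss tau z r0 theta0 <= qcels_loss tau z r theta.

(* Main.v *)
(* The minimizer is compared with the pair (p0, lambda_0). After rotation by
   cis (lambda_0 n tau), the data are p0 + q_n with q = (other eigenvalues) + noise,
   the fit is a cis (x n), and minimality gives |v|^2 <= 2 Re <q, v> for
   v_n = a cis (x n) - p0. Since |v| is at least of order |a| min (N |x|, 1), it is
   enough that the other eigenvalues contribute at most 1 - p0 to q, and that the
   correlation of the noise with v is at most a small multiple of delta |v|. By
   summation by parts the latter follows from a bound by a small multiple of delta N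
   on the partial sums of the noise modulated by the N frequencies 2 pi k / N.
   Chernoff's bound fails for one of these O(N^2) sums with probability at most
   exp (- c delta^2 N Ns), and the factor delta^(-zeta) in the hypothesis on N Ns
   pays for the factor N^2 of the union bound. *)

Require Import Defs.
From mathcomp Require Import all_boot all_order all_algebra.
From mathcomp Require Import all_classical all_reals all_analysis.
From mathcomp Require Import complex.
From mathcomp Require Import zify ring lra.

Set Implicit Arguments.
Unset Strict Implicit.
Unset Printing Implicit Defensive.

Import Order.TTheory GRing.Theory Num.Theory.
Import numFieldNormedType.Exports Normc.

Local Open Scope classical_set_scope.
Local Open Scope complex_scope.
Local Open Scope ring_scope.
Local Open Scope sesquilinear_scope.

(** * The modulus of complex numbers *)

Lemma normc_sqr (R : realType) (z : R[i]) :
  normc z ^+ 2 = complex.Re z ^+ 2 + complex.Im z ^+ 2.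
Proof. by case: z => a b /=; rewrite sqr_sqrtr // addr_ge0 ?sqr_ge0. Qed.

Lemma normc_ge0 (R : realType) (z : R[i]) : 0 <= normc z.
Proof. by case: z => a b /=; rewrite sqrtr_ge0. Qed.

Lemma normcD_le (R : realType) (x y : R[i]) : normc (x + y) <= normc x + normc y.
Proof. exact: le_normcD. Qed.

Lemma normc_opp (R : realType) (x : R[i]) : normc (- x) = normc x.
Proof. exact: normcN. Qed.

Lemma normcB_le (R : realType) (x y : R[i]) : normc (x - y) <= normc x + normc y.
Proof. by rewrite -(normc_opp y) normcD_le. Qed.

Lemma normc_sum (R : realType) (I : Type) (r : seq I) (P : pred I) (f : I -> R[i]) :
  normc (\sum_(i <- r | P i) f i) <= \sum_(i <- r | P i) normc (f i).
Proof.
elim/big_rec2: _ => [|i y z _ le_zy]; first by rewrite normc0.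
by apply: (le_trans (normcD_le _ _)); rewrite lerD2l.
Qed.

Lemma normc_real (R : realType) (x : R) : normc x%:C = `|x|.
Proof. by rewrite /= expr0n addr0 sqrtr_sqr. Qed.

Lemma normc_ReIm (R : realType) (z : R[i]) :
  normc z <= `|complex.Re z| + `|complex.Im z|.
Proof.
have := normcD_le (complex.Re z)%:C ('i * (complex.Im z)%:C).
by rewrite -complexE normcM !normc_real /= expr0n expr1n add0r sqrtr1 mul1r.
Qed.

Lemma Re_le_normc (R : realType) (z : R[i]) : complex.Re z <= normc z.
Proof.
apply: (le_trans (ler_norm _)); rewrite -(ler_pXn2r (ltn0Sn 1)) ?nnegrE ?normc_ge0 //.
by rewrite normc_sqr -normrX ger0_norm ?sqr_ge0 // lerDl sqr_ge0.
Qed.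

Lemma normc_conj (R : realType) (z : R[i]) : normc z^* = normc z.
Proof. by case: z => a b /=; rewrite sqrrN. Qed.

(** * Points of the unit circle and their distance to 1 *)

Section Cis.
Variable R : realType.
Implicit Types x y : R.

Lemma cis0 : cis 0 = 1 :> R[i].
Proof. by rewrite /cis cos0 sin0. Qed.

Lemma cisD x y : cis (x + y) = cis x * cis y.
Proof. by rewrite /cis cosD sinD; simpc; congr (_ +i* _); ring. Qed.

Lemma cisN x : cis (- x) = (cis x)^*.
Proof. by rewrite /cis cosN sinN. Qed.

Lemma normc_cis x : normc (cis x) = 1.
Proof. by rewrite /= cos2Dsin2 sqrtr1. Qed.

Lemma cis_mulVl x : cis (- x) * cis x = 1.
Proof. by rewrite -cisD addNr cis0. Qed.

Lemma cis2piz (k : int) : cis (2 * pi * k%:~R) = 1 :> R[i].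
Proof.
suff H n : cis (2 * pi * n%:R) = 1 :> R[i].
  case: (intP k) => [|n|n].
  - by rewrite mulr0 cis0.
  - exact: H.
  - by rewrite mulrNz mulrN cisN H rmorph1.
elim: n => [|n IHn]; first by rewrite mulr0 cis0.
by rewrite -[n.+1%:R]natr1 mulrDr cisD IHn mul1r mulr1 mulr_natl /cis cos2pi sin2pi.
Qed.

Lemma normc_cisB1_sqr x : normc (cis x - 1) ^+ 2 = 4 * sin (x / 2) ^+ 2.
Proof.
rewrite normc_sqr.
rewrite /= oppr0 addr0.
have -> : cos x = cos (x / 2) ^+ 2 *+ 2 - 1.
  by rewrite -cos_mulr2n -[_ *+ 2]mulr_natr divfK.
have -> : sin x = cos (x / 2) * sin (x / 2) *+ 2.
  by rewrite -sin_mulr2n -[_ *+ 2]mulr_natr divfK.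
rewrite -mulrnAl exprMn sin2cos2; ring.
Qed.

Lemma sin_mvt x : 0 <= x -> exists2 c, 0 <= c <= x & sin x = cos c * x.
Proof.
move=> x0; have hs : {within `[0, x], continuous (@sin R)}.
  exact/continuous_subspaceT/continuous_sin.
have [c] := MVT_segment x0 (fun y _ => is_derive_sin y) hs.
by rewrite sin0 !subr0 in_itv; exists c.
Qed.

Lemma normr_sin_le x : `|sin x| <= `|x|.
Proof.
wlog x0 : x / 0 <= x => [H|].
  by have [/H//|/ltW] := leP 0 x; rewrite -oppr_ge0 => /H; rewrite sinN !normrN.
by have [c _ ->] := sin_mvt x0; rewrite normrM ler_piMl // cos_max.
Qed.

(** [cos] decreases on [[0, pi]], so its value at the intermediate point of the mean value theorem
    is at least [cos x]. *)
Lemma sin_ge_cos x : 0 <= x <= pi -> cos x * x <= sin x.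
Proof.
case/andP=> x0 xpi; have [c /andP[c0 cx] ->] := sin_mvt x0.
apply: ler_wpM2r => //; have [->//|nex] := eqVneq c x.
apply/ltW; rewrite ltr_cos ?in_itv /= ?c0 ?x0 ?(le_trans cx) //.
by rewrite lt_neqAle nex.
Qed.

(** By the double angle formula and [sin_ge_cos] at [x / 2], [sin x] is at least
    [cos (x / 2) ^+ 2 * x], and this squared cosine is at least 1/2 as [cos x] is nonnegative. *)
Lemma sin_ge_half x : 0 <= x <= pi / 2 -> x / 2 <= sin x.
Proof.
case/andP=> x0 xpi; have pi0 := pi_gt0 R.
have := @sin_ge_cos (x / 2); rewrite divr_ge0 //= => /(_ ltac:(lra)) h.
have -> : sin x = cos (x / 2) * sin (x / 2) *+ 2.
  by rewrite -sin_mulr2n -[_ *+ 2]mulr_natr divfK.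
have c0 : 0 <= cos (x / 2) by apply: cos_ge0_pihalf; lra.
have c1 : 1 / 2 <= cos (x / 2) ^+ 2.
  have -> : cos (x / 2) ^+ 2 = (1 + cos x) / 2.
    have -> : cos x = cos (x / 2) ^+ 2 *+ 2 - 1.
      by rewrite -cos_mulr2n -[_ *+ 2]mulr_natr divfK.
    by field.
  have : 0 <= cos x by apply: cos_ge0_pihalf; lra.
  lra.
have : cos (x / 2) * (cos (x / 2) * (x / 2)) <= cos (x / 2) * sin (x / 2).
  exact: ler_wpM2l.
have : (1 / 2) * (x / 2) <= cos (x / 2) ^+ 2 * (x / 2).
  by apply: ler_wpM2r => //; lra.
rewrite expr2 mulrA; lra.
Qed.

Lemma normc_cisB1_le x : normc (cis x - 1) <= `|x|.
Proof.
rewrite -(ler_pXn2r (ltn0Sn 1)) ?nnegrE ?normc_ge0 // normc_cisB1_sqr.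
have : sin (x / 2) ^+ 2 <= (x / 2) ^+ 2.
  by rewrite -ler_sqrt ?sqr_ge0 // !sqrtr_sqr normr_sin_le.
by rewrite real_normK ?num_real // expr_div_n; lra.
Qed.

Lemma normc_cisB1_ge x : `|x| <= pi -> x ^+ 2 / 4 <= normc (cis x - 1) ^+ 2.
Proof.
move=> xpi; rewrite normc_cisB1_sqr.
wlog x0 : x xpi / 0 <= x => [H|].
  have [/H|/ltW] := leP 0 x; first exact.
  rewrite -oppr_ge0 => /H; rewrite normrN => /(_ xpi).
  by rewrite sqrrN mulNr sinN sqrrN.
rewrite ger0_norm // in xpi.
have h : x / 2 / 2 <= sin (x / 2) by apply: sin_ge_half; lra.
have : (x / 2 / 2) ^+ 2 <= sin (x / 2) ^+ 2.
  by apply: lerXn2r; rewrite // nnegrE ?divr_ge0 // (le_trans _ h) // !divr_ge0.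
rewrite !expr_div_n; lra.
Qed.

End Cis.

(** * Summation by parts and sums modulated by an arbitrary frequency *)

Section Abel.
Variable R : realType.
Implicit Types w c : nat -> R[i].

Lemma sum_by_parts w c m :
  \sum_(n < m.+1) w n * c n = (\sum_(n < m.+1) w n) * c m
    - \sum_(n < m) (\sum_(j < n.+1) w j) * (c n.+1 - c n).
Proof.
elim: m => [|m IHm]; first by rewrite !big_ord1 big_ord0 subr0.
rewrite big_ord_recr /= IHm [X in _ = X * _ - _]big_ord_recr /=.
rewrite [X in _ = _ - X]big_ord_recr /=; ring.
Qed.

(** The factor of [B] is the last value of [c] plus its total variation, so a slowly varying
    modulation costs little. *)
Lemma abel_bound w c (B : R) m :
  (forall k, (k <= m.+1)%N -> normc (\sum_(n < k) w n) <= B) ->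
  normc (\sum_(n < m.+1) w n * c n) <=
    B * (normc (c m) + \sum_(n < m) normc (c n.+1 - c n)).
Proof.
move=> hB; rewrite sum_by_parts (le_trans (normcB_le _ _)) // mulrDr lerD //.
  by rewrite normcM ler_wpM2r ?normc_ge0 ?hB.
rewrite mulr_sumr (le_trans (normc_sum _ _ _)) //.
by apply: ler_sum => n _; rewrite normcM ler_wpM2r ?normc_ge0 ?hB // ltnW // ltnS.
Qed.

Lemma normc_cisB (x y : R) : normc (cis x - cis y) <= `|x - y|.
Proof.
have -> : cis x - cis y = cis y * (cis (x - y) - 1).
  by rewrite mulrBr mulr1 -cisD [y + _]addrC subrK.
by rewrite normcM normc_cis mul1r normc_cisB1_le.
Qed.

Lemma sum_normc_cisB (x : R) m :
  \sum_(n < m) normc (cis (x * n.+1%:R) - cis (x * n%:R)) <= m%:R * `|x|.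
Proof.
have -> : m%:R * `|x| = \sum_(n < m) `|x|.
  by rewrite mulr_natl sumr_const card_ord.
apply: ler_sum => n _; apply: le_trans (normc_cisB _ _) _.
by rewrite -mulrBr -[n.+1%:R]natr1 addrAC subrr add0r mulr1.
Qed.

Lemma twisted_sum_bound w (B x : R) N : 0 <= B ->
  (forall m, (m <= N)%N -> normc (\sum_(n < m) w n) <= B) ->
  normc (\sum_(n < N) w n * cis (x * n%:R)) <= B * (1 + N%:R * `|x|).
Proof.
case: N => [|N] B0 hB; first by rewrite big_ord0 normc0 mul0r addr0 mulr1.
apply: le_trans (@abel_bound w (fun n => cis (x * n%:R)) _ N hB) _.
rewrite ler_wpM2l // normc_cis lerD2l (le_trans (sum_normc_cisB _ _)) //.
by rewrite ler_wpM2r // ler_nat.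
Qed.

(** The last value and the total variation of [cis (x * n%:R) - 1] are each at most [N%:R * |x|];
    unlike in [twisted_sum_bound], the bound vanishes with [x]. *)
Lemma twisted_sum_diff_bound w (B x : R) N : 0 <= B ->
  (forall m, (m <= N)%N -> normc (\sum_(n < m) w n) <= B) ->
  normc (\sum_(n < N) w n * (cis (x * n%:R) - 1)) <= B * (2 * (N%:R * `|x|)).
Proof.
case: N => [|N] B0 hB; first by rewrite big_ord0 normc0 mul0r !mulr0.
apply: le_trans (@abel_bound w (fun n => cis (x * n%:R) - 1) _ N hB) _.
rewrite ler_wpM2l // mulr_natl mulr2n lerD //.
  apply: le_trans (normc_cisB1_le _) _.
  by rewrite normrM mulrC ger0_norm // ler_wpM2r // ler_nat.
have -> : \sum_(n < N) normc (cis (x * n.+1%:R) - 1 - (cis (x * n%:R) - 1)) =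
          \sum_(n < N) normc (cis (x * n.+1%:R) - cis (x * n%:R)).
  by apply: eq_bigr => n _; congr normc; ring.
by rewrite (le_trans (sum_normc_cisB _ _)) // ler_wpM2r // ler_nat.
Qed.

Definition grid_angle (N k : nat) : R := 2 * pi * k%:R / N%:R.

(** Finitely many frequencies control all of them: modulo [2 * pi], [x] is a grid frequency plus a
    remainder [y] with [N%:R * |y|] at most [2 * pi], hence at most 8, and [twisted_sum_bound] gives
    the factor 1 + 8. *)
Lemma grid_sum_bound w (B x : R) N : (0 < N)%N -> 0 <= B ->
  (forall k m, (k < N)%N -> (m <= N)%N ->
     normc (\sum_(n < m) w n * cis (grid_angle N k * n%:R)) <= B) ->
  normc (\sum_(n < N) w n * cis (x * n%:R)) <= 9 * B.
Proof.
move=> N0 B0 hB; have [p [pE pi0 pi4]] : exists p : R, [/\ p = pi, 0 < p & p <= 4].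
  by exists pi; rewrite pi_gt0; split=> //; have := @pihalf_lt2 R; lra.
have N0R : 0 < N%:R :> R by rewrite ltr0n.
(* The integer [k'] may lie outside [[0, N)]; its residue [k] modulo [N] indexes the same grid
   frequency up to a multiple of [2 * pi]. *)
pose k' := Num.floor (x * N%:R / (2 * p)).
have hk : k'%:~R <= x * N%:R / (2 * p) < k'%:~R + 1.
  by have := floor_itv (x * N%:R / (2 * p)); rewrite intrD.
pose k := `|(k' %% N%:Z)%Z|%N.
have Nz : N%:Z != 0 by rewrite eqz_nat -lt0n.
have kE : k%:Z = (k' %% N%:Z)%Z by rewrite /k gez0_abs ?modz_ge0.
have kN : (k < N)%N by rewrite -ltz_nat kE ltz_pmod.
pose y := x - 2 * p * k'%:~R / N%:R.
have hy : `|y| * N%:R <= 8.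
  rewrite -[X in _ * X](gtr0_norm N0R) -normrM.
  have -> : y * N%:R = 2 * p * (x * N%:R / (2 * p) - k'%:~R).
    by rewrite /y; field; rewrite !gt_eqF.
  case/andP: hk => h1 h2.
  rewrite ger0_norm; last by rewrite mulr_ge0 ?subr_ge0 // mulr_ge0 // ltW.
  apply: (@le_trans _ _ (2 * p * 1)); last by lra.
  by apply: ler_wpM2l; [rewrite mulr_ge0 // ltW | rewrite lerBlDr addrC ltW].
have -> : \sum_(n < N) w n * cis (x * n%:R) =
    \sum_(n < N) (w n * cis (grid_angle N k * n%:R)) * cis (y * n%:R).
  apply: eq_bigr => n _; rewrite -mulrA -cisD; congr (_ * _).
  have -> : x * n%:R = (grid_angle N k * n%:R + y * n%:R)
     + 2 * p * ((k' %/ N%:Z)%Z * n%:Z)%:~R.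
    rewrite /y /grid_angle -pE.
    have -> : k%:R = k'%:~R - ((k' %/ N%:Z)%Z * N%:Z)%:~R :> R.
      by rewrite [X in X%:~R - _](divz_eq k' N) intrD addrAC subrr add0r -kE.
    by rewrite !intrM; field; rewrite gt_eqF.
  by rewrite [LHS]cisD pE cis2piz mulr1.
have /le_trans -> // := @twisted_sum_bound
  (fun n => w n * cis (grid_angle N k * n%:R)) B y N B0 (fun m => hB k m kN).
by rewrite mulrC ler_wpM2r //; lra.
Qed.
End Abel.

(** * Deterministic bounds on the change [v] of the fit *)

Section LeastSquares.
Variable R : realType.

Lemma sqrrD_le (a b c : R) : 0 <= c -> c <= a + b -> c ^+ 2 <= 2 * a ^+ 2 + 2 * b ^+ 2.
Proof. move=> c0 cab; have := sqr_ge0 (a - b); nra. Qed.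

(* A shift [h] keeping [x h] within half a period, so that [|cis (x h) - 1|] is
   comparable to [|x h|]. *)
Lemma exists_shift (N : nat) (x : R) : (1 < N)%N -> `|x| <= pi ->
  exists h : nat, [/\ (h.*2 <= N)%N, h%:R * `|x| <= pi &
    Num.min (N%:R * `|x| / 3) 1 <= h%:R * `|x|].
Proof.
move=> N1; have [->|x0] := eqVneq x 0.
  by exists 0%N; rewrite normr0 !mulr0 mul0r pi_ge0 ge_min lexx.
have := @pi_ge2 R; move: (pi : R) => p p2 xp.
have ax : 0 < `|x| by rewrite normr_gt0.
(* The largest [m] with [m%:R * |x|] at most [pi]; the shift is the smaller of [m] and [N./2]. *)
pose m := Num.truncn (p / `|x|).
have [m1 m2] : m%:R <= p / `|x| /\ p / `|x| < m.+1%:R.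
  by apply/andP; apply: truncn_itv; rewrite divr_ge0 // ltW // (lt_le_trans _ p2).
rewrite ler_pdivlMr // in m1; rewrite ltr_pdivrMr // in m2.
have mp : (0 < m)%N.
  by rewrite lt0n; apply: contraTneq m2 => ->; rewrite mul1r -leNgt.
have [h1|h1] := leqP N./2 m.
  exists N./2; split.
  - by rewrite -[X in (_ <= X)%N]odd_double_half leq_addl.
  - by apply: le_trans m1; rewrite ler_wpM2r // ler_nat.
  rewrite ge_min mulrAC ler_wpM2r // ler_pdivrMr // -natrM ler_nat.
  have := odd_double_half N; rewrite -!muln2.
  by case: N N1 h1 => [|[|[|[|N]]]] //= _ _; lia.
exists m; split => //.
  apply: (@leq_trans N./2.*2); first by rewrite leq_double ltnW.
  by rewrite -[X in (_ <= X)%N]odd_double_half leq_addl.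
(* Since [m] is positive, [m%:R * |x|] is at least half of [m.+1%:R * |x|], which exceeds 2. *)
rewrite ge_min; apply/orP; right.
have : 1 <= m%:R :> R by rewrite ler1n.
rewrite -natr1 in m2; nra.
Qed.

Variables (N : nat) (x p0 : R) (a : R[i]).
Hypotheses (N1 : (1 < N)%N) (xpi : `|x| <= pi).
Let v (n : nat) : R[i] := a * cis (x * n%:R) - p0%:C.
(** The visible size of the frequency error: proportional to the phase accumulated over the window
    until it saturates. *)
Let mu := Num.min (N%:R * `|x| / 3) 1.

Lemma mu_ge0 : 0 <= mu.
Proof. by rewrite le_min ler01 andbT divr_ge0 // mulr_ge0. Qed.

Lemma sum_shift_le (f : nat -> R) (h m : nat) : (forall n, 0 <= f n) -> (h <= m)%N ->
  \sum_(n < m - h) f (n + h)%N <= \sum_(n < m) f n.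
Proof.
move=> f0 hm; have -> : \sum_(n < m) f n = \sum_(n < h + (m - h)) f n by rewrite subnKC.
rewrite big_split_ord /= -[leLHS]add0r lerD ?sumr_ge0 //.
by apply: ler_sum => n _; rewrite addnC.
Qed.

Lemma sum_prefix_le (f : nat -> R) (h m : nat) : (forall n, 0 <= f n) -> (h <= m)%N ->
  \sum_(n < m - h) f n <= \sum_(n < m) f n.
Proof.
move=> f0 hm; have -> : \sum_(n < m) f n = \sum_(n < (m - h) + h) f n by rewrite subnK.
by rewrite big_split_ord /= lerDl sumr_ge0.
Qed.

(** Subtracting [v n] from [v (n + h)] cancels [p0] and leaves modulus at least [normc a * mu / 2].
    As [h] is at most [N / 2], at least half of the indices have such a partner. *)
Lemma residual_ge_sin :
  N%:R * (normc a * mu) ^+ 2 <= 32 * \sum_(n < N) normc (v n) ^+ 2.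
Proof.
have [h [hN hpi hmu]] := exists_shift N1 xpi.
have hN' : (h <= N)%N by rewrite (leq_trans _ hN) // -addnn leq_addr.
have step n : (normc a * mu) ^+ 2 <=
    8 * (normc (v n) ^+ 2 + normc (v (n + h)%N) ^+ 2).
  have e : normc (v (n + h)%N - v n) = normc a * normc (cis (x * h%:R) - 1).
    rewrite -normcM -[RHS]mulr1 -[X in _ = _ * X](normc_cis (x * n%:R)) -normcM; congr normc.
    by rewrite /v natrD mulrDr cisD; ring.
  have h1 : (x * h%:R) ^+ 2 / 4 <= normc (cis (x * h%:R) - 1) ^+ 2.
    by apply: normc_cisB1_ge; rewrite normrM mulrC ger0_norm.
  have h2 : mu ^+ 2 <= (x * h%:R) ^+ 2.
    rewrite -(real_normK (num_real (x * h%:R))) normrM [`|h%:R|]ger0_norm //.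
    by apply: lerXn2r; rewrite ?nnegrE ?mu_ge0 ?mulr_ge0 // mulrC.
  have h3 := sqrrD_le (normc_ge0 (v (n + h)%N - v n)) (normcB_le _ _).
  have : normc a ^+ 2 * mu ^+ 2 <=
      normc a ^+ 2 * (4 * normc (cis (x * h%:R) - 1) ^+ 2).
    by apply: ler_wpM2l; [exact: sqr_ge0 | lra].
  rewrite e exprMn in h3; rewrite exprMn; lra.
have : \sum_(n < N - h) (normc a * mu) ^+ 2 <=
   \sum_(n < N - h) (8 * (normc (v n) ^+ 2 + normc (v (n + h)%N) ^+ 2)).
  by apply: ler_sum => n _; exact: step.
rewrite sumr_const card_ord -mulr_sumr big_split /= -mulr_natl => H.
have s1 : \sum_(n < N - h) normc (v (n + h)%N) ^+ 2 <= \sum_(n < N) normc (v n) ^+ 2.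
  by apply: (sum_shift_le (f := fun n => normc (v n) ^+ 2)) => // n; exact: sqr_ge0.
have s2 : \sum_(n < N - h) normc (v n) ^+ 2 <= \sum_(n < N) normc (v n) ^+ 2.
  by apply: (sum_prefix_le (f := fun n => normc (v n) ^+ 2)) => // n; exact: sqr_ge0.
have h4 : N%:R <= 2 * (N - h)%:R :> R by rewrite -natrM ler_nat; lia.
have := ler_wpM2r (sqr_ge0 (normc a * mu)) h4.
lra.
Qed.

(** Each [a - p0%:C] equals [v n - a * (cis (x * n%:R) - 1)], whose second term is at most
    [3 * (normc a * mu)]. *)
Lemma amplitude_error_le : N%:R * normc (a - p0%:C) ^+ 2 <=
  2 * \sum_(n < N) normc (v n) ^+ 2 + 18 * (N%:R * (normc a * mu) ^+ 2).
Proof.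
have -> : N%:R * normc (a - p0%:C) ^+ 2 = \sum_(n < N) normc (a - p0%:C) ^+ 2.
  by rewrite mulr_natl sumr_const card_ord.
have -> : 2 * \sum_(n < N) normc (v n) ^+ 2 + 18 * (N%:R * (normc a * mu) ^+ 2) =
  \sum_(n < N) (2 * normc (v n) ^+ 2 + 18 * (normc a * mu) ^+ 2).
  by rewrite big_split /= -mulr_sumr sumr_const card_ord -mulr_natl; ring.
apply: ler_sum => n _.
have e : a - p0%:C = v n - a * (cis (x * n%:R) - 1) by rewrite /v; ring.
(* The modulus is at most both [N%:R * |x|] and 2, hence at most three times either entry of the
   minimum. *)
have h1 : normc (cis (x * n%:R) - 1) <= 3 * mu.
  rewrite -ler_pdivrMl // le_min; apply/andP; split.
    rewrite mulrC ler_wpM2r // (le_trans (normc_cisB1_le _)) //.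
    by rewrite normrM mulrC ger0_norm // ler_wpM2r // ler_nat ltnW.
  have := normcB_le (cis (x * n%:R)) 1; rewrite normc_cis normc1; lra.
have h2 := sqrrD_le (normc_ge0 _) (normcB_le (v n) (a * (cis (x * n%:R) - 1))).
rewrite -e normcM exprMn in h2.
have h3 : normc (cis (x * n%:R) - 1) ^+ 2 <= 9 * mu ^+ 2.
  by have := normc_ge0 (cis (x * n%:R) - 1); have := mu_ge0; nra.
have := ler_wpM2l (sqr_ge0 (normc a)) h3.
rewrite exprMn; lra.
Qed.

(** This keeps [a] away from 0 when the residual is small, so that [residual_ge_sin] then forces
    [mu] to be small. *)
Lemma amplitude_ge : N%:R * p0 ^+ 2 <=
  2 * \sum_(n < N) normc (v n) ^+ 2 + 2 * (N%:R * normc a ^+ 2).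
Proof.
have -> : N%:R * p0 ^+ 2 = \sum_(n < N) p0 ^+ 2.
  by rewrite mulr_natl sumr_const card_ord.
have -> : 2 * \sum_(n < N) normc (v n) ^+ 2 + 2 * (N%:R * normc a ^+ 2) =
  \sum_(n < N) (2 * normc (v n) ^+ 2 + 2 * normc a ^+ 2).
  by rewrite big_split /= -mulr_sumr sumr_const card_ord -mulr_natl; ring.
apply: ler_sum => n _.
rewrite -(real_normK (num_real p0)) -normc_real.
have -> : p0%:C = a * cis (x * n%:R) - v n by rewrite /v; ring.
have := sqrrD_le (normc_ge0 _) (normcB_le (a * cis (x * n%:R)) (v n)).
rewrite [normc (a * cis _)]normcM normc_cis mulr1; lra.
Qed.

Variables (w : nat -> R[i]) (B : R).
Hypotheses (B0 : 0 <= B) (hB : forall k m, (k < N)%N -> (m <= N)%N ->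
  normc (\sum_(n < m) w n * cis (grid_angle R N k * n%:R)) <= N%:R * B).

Lemma partial_sum_bound m : (m <= N)%N -> normc (\sum_(n < m) w n) <= N%:R * B.
Proof.
move=> mN; have -> : \sum_(n < m) w n =
    \sum_(n < m) w n * cis (grid_angle R N 0 * n%:R).
  by apply: eq_bigr => n _; rewrite /grid_angle mulr0 !mul0r cis0 mulr1.
exact: hB (ltnW N1) mN.
Qed.

(** Split [v n] into [a - p0%:C] and [a * (cis (x * n%:R) - 1)]. Both resulting terms are measured
    by quantities that the residual controls, uniformly in [x]. *)
Lemma noise_correlation_le : normc (\sum_(n < N) w n * v n) <=
  N%:R * (B * (normc (a - p0%:C) + 10 * (normc a * mu))).
Proof.
have NB0 : 0 <= N%:R * B by rewrite mulr_ge0.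
have -> : \sum_(n < N) w n * v n = (a - p0%:C) * (\sum_(n < N) w n)
    + a * \sum_(n < N) w n * (cis (x * n%:R) - 1).
  by rewrite !mulr_sumr -big_split; apply: eq_bigr => n _; rewrite /v /=; ring.
apply: le_trans (normcD_le _ _) _; rewrite !normcM !mulrDr lerD //.
  by rewrite [leRHS]mulrA [leRHS]mulrC ler_wpM2l ?normc_ge0 // partial_sum_bound.
have -> : N%:R * (B * (10 * (normc a * mu))) = normc a * (N%:R * B * (10 * mu)) by ring.
rewrite ler_wpM2l ?normc_ge0 // {1}/mu.
(* While [mu] is [N%:R * |x| / 3], summation by parts gives [6 * mu]; once [mu] is 1, the grid bound
   and the plain sum give 9 + 1. *)
rewrite minEle; case: ifP => [_|/negbT]; last rewrite -ltNge => xfar.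
  apply: le_trans (twisted_sum_diff_bound x NB0 partial_sum_bound) _.
  by rewrite ler_wpM2l //; have : 0 <= N%:R * `|x| by []; lra.
have -> : \sum_(n < N) w n * (cis (x * n%:R) - 1) =
    \sum_(n < N) w n * cis (x * n%:R) - \sum_(n < N) w n.
  by rewrite -sumrB; apply: eq_bigr => n _; ring.
apply: le_trans (normcB_le _ _) _.
have := grid_sum_bound x (ltnW N1) NB0 hB.
have := partial_sum_bound (leqnn N); lra.
Qed.

End LeastSquares.

(** * From minimality to the frequency error *)

Section Core.
Variable R : realType.

Lemma normcB_sqr (q v : R[i]) :
  normc (q - v) ^+ 2 = normc q ^+ 2 + normc v ^+ 2 - 2 * complex.Re (q^* * v).
Proof. by rewrite !normc_sqr; case: q => a b; case: v => c d /=; ring. Qed.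

Lemma Re_sum (I : Type) (r : seq I) (f : I -> R[i]) :
  complex.Re (\sum_(i <- r) f i) = \sum_(i <- r) complex.Re (f i).
Proof. by elim/big_rec2: _ => [//|i y z _ <-]; case: (f i); case: z. Qed.

(** With [V] the mean square of [v], minimality and the correlation bound give [V] of order
    [rho ^+ 2 + B ^+ 2], hence a small multiple of [delta ^+ 2]. Then [a] is bounded below, and
    [residual_ge_sin] yields [mu < delta / 4]. *)
Lemma least_squares_core (N : nat) (x p0 rho B delta : R) (a : R[i])
    (r w : nat -> R[i]) :
  (1 < N)%N -> `|x| <= pi -> 71 / 100 <= p0 -> 0 < delta <= 4 -> 0 <= B ->
  (forall n, (n < N)%N -> normc (r n) <= rho) ->
  (forall k m, (k < N)%N -> (m <= N)%N ->
    normc (\sum_(n < m) w n * cis (grid_angle R N k * n%:R)) <= N%:R * B) ->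
  \sum_(n < N) normc (r n + (w n)^* - (a * cis (x * n%:R) - p0%:C)) ^+ 2 <=
    \sum_(n < N) normc (r n + (w n)^*) ^+ 2 ->
  300 * rho <= delta -> 400 * (100 * B) <= delta ->
  N%:R * `|x| < delta.
Proof.
move=> N1 xpi p071 /andP[d0 d4] B0 hr hw hmin hrho hB.
have N0 : 0 < N%:R :> R by rewrite ltr0n ltnW.
pose v n := a * cis (x * n%:R) - p0%:C.
pose mu := Num.min (N%:R * `|x| / 3) 1.
have mu0 : 0 <= mu := mu_ge0 N x.
have G1 := residual_ge_sin p0 a N1 xpi.
have G2 := amplitude_error_le N x p0 a.
have G3 := amplitude_ge N x p0 a.
have G4 := noise_correlation_le x p0 a N1 B0 hw.
rewrite -/mu in G1 G2 G4.
have rho0 : 0 <= rho := le_trans (normc_ge0 _) (hr _ (ltnW N1)).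
(* Expanding the squares leaves twice the correlation with [v]. The part of [r] is absorbed termwise
   into half of [normc (v n) ^+ 2]; the noise stays a single sum, to keep its cancellations. *)
have opt : \sum_(n < N) normc (v n) ^+ 2 <=
    N%:R * (4 * rho ^+ 2) + 4 * normc (\sum_(n < N) w n * v n).
  have : 0 <= \sum_(n < N) (normc (r n + (w n)^*) ^+ 2 -
      normc (r n + (w n)^* - (a * cis (x * n%:R) - p0%:C)) ^+ 2).
    by rewrite sumrB subr_ge0.
  have le1 (n : 'I_N) : normc (r n + (w n)^*) ^+ 2 -
      normc (r n + (w n)^* - (a * cis (x * n%:R) - p0%:C)) ^+ 2 <=
      2 * rho ^+ 2 - normc (v n) ^+ 2 / 2 + 2 * complex.Re (w n * v n).
    rewrite -/(v n) normcB_sqr.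
    have -> : (r n + (w n)^*)^* = (r n)^* + w n.
      by case: (r n) => ? ?; case: (w n) => ? ? /=; congr (_ +i* _); ring.
    rewrite [X in complex.Re X]mulrDl.
    have -> : complex.Re ((r n)^* * v n + w n * v n) =
       complex.Re ((r n)^* * v n) + complex.Re (w n * v n).
      by case: (_ * v n); case: (_ * v n).
    have := Re_le_normc ((r n)^* * v n); rewrite normcM normc_conj.
    have := hr n (ltn_ord n); have := normc_ge0 (r n); have := normc_ge0 (v n).
    move: (normc (v n)) (normc (r n)) => s t s0 t0 ht.
    have := sqr_ge0 (s - 2 * t); have : t ^+ 2 <= rho ^+ 2 by nra.
    lra.
  move=> /le_trans/(_ (ler_sum _ (fun n _ => le1 n))).
  rewrite big_split sumrB /= -!mulr_sumr -mulr_suml sumr_const card_ord -mulr_natl.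
  rewrite -Re_sum.
  have := Re_le_normc (\sum_(n < N) w n * v n); lra.
have NV0 : 0 <= \sum_(n < N) normc (v n) ^+ 2.
  by apply: sumr_ge0 => n _; exact: sqr_ge0.
rewrite -/(v _) in G1 G2 G3 G4 opt NV0.
pose V := (\sum_(n < N) normc (v n) ^+ 2) / N%:R.
have VE : \sum_(n < N) normc (v n) ^+ 2 = N%:R * V by rewrite mulrC divfK ?gt_eqF.
have {}opt := le_trans opt (lerD (lexx _) (ler_wpM2l (ler0n _ 4) G4)).
rewrite VE in G1 G2 G3 opt NV0.
rewrite pmulr_rge0 // in NV0.
have {}G1 : (normc a * mu) ^+ 2 <= 32 * V by rewrite -(ler_pM2l N0); lra.
have {}G2 : normc (a - p0%:C) ^+ 2 <= 2 * V + 18 * (normc a * mu) ^+ 2.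
  by rewrite -(ler_pM2l N0); lra.
have {}G3 : p0 ^+ 2 <= 2 * V + 2 * normc a ^+ 2 by rewrite -(ler_pM2l N0); lra.
have {}opt : V <= 4 * rho ^+ 2 + 4 * (B * (normc (a - p0%:C) + 10 * (normc a * mu))).
  by rewrite -(ler_pM2l N0); lra.
have A0 := normc_ge0 a; have D0 := normc_ge0 (a - p0%:C).
move: (normc (a - p0%:C)) (normc a) D0 A0 G1 G2 G3 opt => D A D0 A0 G1 G2 G3 opt.
have Am0 : 0 <= A * mu by rewrite mulr_ge0.
have V1 : V <= 8 * rho ^+ 2 + 13 * (100 * B) ^+ 2.
  (* By [G1] and [G2], [D ^+ 2] is at most [578 * V] and [(A * mu) ^+ 2] at most [32 * V]; the
     weights in the two squares make the cross terms absorb less than half of [V]. *)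
  have := sqr_ge0 (D / 50 - 100 * B).
  have := sqr_ge0 (A * mu / 12 - 12 / 5 * (100 * B)).
  have := sqr_ge0 rho; have := sqr_ge0 B; lra.
have sq (s t : R) : 0 <= s -> s <= t -> s ^+ 2 <= t ^+ 2.
  by move=> s0 st; apply: lerXn2r => //; rewrite nnegrE (le_trans s0).
have rho2 := sq _ _ (mulr_ge0 (ler0n _ _) rho0) hrho.
have B2 := sq _ _ (mulr_ge0 (ler0n _ _) (mulr_ge0 (ler0n _ _) B0)) hB.
have d16 : delta ^+ 2 <= 16 by nra.
have V2 : V <= delta ^+ 2 / 50 / 100 by lra.
have A2 : 1 / 5 <= A ^+ 2 by nra.
have mu2 : mu ^+ 2 < (delta / 4) ^+ 2.
  rewrite exprMn in G1.
  have : 1 / 5 * mu ^+ 2 <= A ^+ 2 * mu ^+ 2 by rewrite ler_wpM2r ?sqr_ge0.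
  have : 0 < delta ^+ 2 by rewrite exprn_gt0.
  rewrite expr_div_n; lra.
have : mu < delta / 4.
  rewrite ltNge; apply/negP => h.
  have d40 : 0 <= delta / 4 by rewrite divr_ge0 // ltW.
  by have := lt_le_trans mu2 (sq _ _ d40 h); rewrite ltxx.
(* As [delta] is at most 4, the entry 1 of the minimum is excluded, and the other gives
   [N%:R * |x| < 3 * delta / 4]. *)
rewrite /mu gt_min => /orP[|]; lra.
Qed.

End Core.

(** * Union bound and Chernoff bound for weighted sums of independent signs *)

Section Probability.
Variables (R : realType) (d : measure_display) (T : measurableType d)
  (P : probability T R).

Lemma union_bound (I : finType) (A : I -> set T) (E : set T) :
  measurable E -> (forall i, measurable (A i)) ->
  (forall w, E w -> exists i, A i w) -> (P E <= \sum_i P (A i))%E.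
Proof.
move=> mE mA EA.
have mU (r : seq I) : measurable (\big[setU/set0]_(i <- r) A i).
  by apply: bigsetU_measurable.
apply: (@le_trans _ _ (P (\big[setU/set0]_i A i))).
  apply: le_measure; rewrite ?inE //.
  by move=> w /EA[i Aiw]; rewrite -bigcup_seq; exists i => //=; rewrite mem_index_enum.
elim: (index_enum I) => [|i r IHr]; first by rewrite !big_nil measure0.
rewrite !big_cons (le_trans (measureU2 _ _ _)) //.
by rewrite leeD2l.
Qed.

(** Inverting [1 - y <= expR (- y)] bounds the exponential by [(1 - y)^-1], and
    [(1 - y) * (1 + y + 2 * y ^+ 2)] is [1 + y ^+ 2 * (1 - 2 * y)]. *)
Lemma chernoff_exp_le (y : R) : y <= 1 / 2 -> expR y <= 1 + y + 2 * y ^+ 2.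
Proof.
move=> y1; have h : 0 < 1 - y by lra.
have := expR_ge1Dx (- y); rewrite expRN => h1.
have : expR y <= (1 - y)^-1.
  by rewrite -[expR y]invrK lef_pV2 ?posrE ?invr_gt0 ?expR_gt0.
move/le_trans; apply; rewrite -div1r ler_pdivrMr //.
by have := sqr_ge0 y; nra.
Qed.

Definition sign_val (s : bool) : R := if s then 1 else -1.

(** The moment generating function of a centred sign. In the quadratic bound on the exponentials the
    linear terms cancel, and the variance [4 * (p * q)] is at most 1; [|c| <= 1 / 4] keeps the
    exponents below 1/2. *)
Lemma sign_mgf_le (p q c : R) : 0 <= p -> 0 <= q -> p + q = 1 -> `|c| <= 1 / 4 ->
  p * expR (c * (1 - (p - q))) + q * expR (c * (-1 - (p - q))) <= expR (2 * c ^+ 2).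
Proof.
move=> p0 q0 pq; rewrite ler_norml => /andP[c1 c2].
have -> : 1 - (p - q) = 2 * q by lra.
have -> : -1 - (p - q) = - (2 * p) by lra.
have q1 : q <= 1 by lra.
have p1 : p <= 1 by lra.
have e1 : expR (c * (2 * q)) <= 1 + c * (2 * q) + 2 * (c * (2 * q)) ^+ 2.
  by apply: chernoff_exp_le; nra.
have e2 : expR (c * - (2 * p)) <= 1 + c * - (2 * p) + 2 * (c * - (2 * p)) ^+ 2.
  by apply: chernoff_exp_le; nra.
have := expR_ge1Dx (2 * c ^+ 2); apply: le_trans.
have := ler_wpM2l p0 e1; have := ler_wpM2l q0 e2.
have pq4 : 4 * (p * q) <= 1.
  have e : (p - q) ^+ 2 = (p + q) ^+ 2 - 4 * (p * q) by ring.
  by have := sqr_ge0 (p - q); rewrite e pq; lra.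
have : c ^+ 2 * (4 * (p * q)) <= c ^+ 2 * 1 by rewrite ler_wpM2l ?sqr_ge0.
have eq : p * (1 + c * (2 * q) + 2 * (c * (2 * q)) ^+ 2) +
   q * (1 + c * - (2 * p) + 2 * (c * - (2 * p)) ^+ 2) =
   (p + q) + 8 * c ^+ 2 * (p * q) * (p + q) by ring.
rewrite pq in eq; lra.
Qed.

(** A sign is twice the indicator of the event that it equals 1, minus 1, so its mean determines its
    law. *)
Lemma sign_law (X : {RV P >-> R}) (m : R) :
  (forall w, X w = 1 \/ X w = -1) -> ('E_P[X] = m%:E)%E ->
  exists p q : R, [/\ P (X @^-1` [set 1]) = p%:E, P (X @^-1` [set -1]) = q%:E,
     0 <= p, 0 <= q & p + q = 1 /\ m = p - q].
Proof.
move=> X1 EX; pose A1 := X @^-1` [set 1]; pose A2 := X @^-1` [set -1].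
have mA1 : measurable A1 by apply: measurable_funPTI.
have mA2 : measurable A2 by apply: measurable_funPTI.
have A2E : A2 = ~` A1.
  apply/seteqP; split => w; rewrite /A1 /A2 /=; first by move=> ->; lra.
  by case: (X1 w).
have fin1 : P A1 \is a fin_num by apply: fin_num_measure.
have PA2 : P A2 = (1 - P A1)%E by rewrite A2E probability_setC.
have XE : X = (2 \o* \1_A1) \- cst 1 :> (T -> R).
  apply/funext => w /=; rewrite indicE; case: (X1 w) => Xw.
    by rewrite mem_set // mul1r Xw mulr2n addrK.
  by rewrite memNset ?mul0r ?sub0r /A1 /= ?Xw //; lra.
have L1 : (\1_A1 : T -> R) \in Lfun P 1.
  apply/Lfun1_integrable; exact: integrable_indic.
rewrite XE expectationB ?expectationZl ?expectation_indic ?expectation_cst // in EX.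
- rewrite PA2; move: fin1 EX (measure_ge0 P A1 : (0 <= P A1)%E) (probability_le1 P mA1).
  case: (P A1) => // p _ [<-]; rewrite !lee_fin => p0 p1.
  exists p, (1 - p); split => //; first by rewrite subr_ge0.
  by split; ring.
- exact: Lfun_scale.
- exact: Lfun_cst.
Qed.

(** Written as an intersection over the full set, so that [mutually_independent] applies to it
    directly. *)
Definition sign_pattern (J : finType) (W : J -> {RV P >-> R}) (s : {ffun J -> bool}) :=
  \bigcap_(j in [set` [set: J]%SET]) (W j @^-1` [set sign_val (s j)]).

(* Chernoff's method, with expectations computed as finite sums over sign patterns. *)
Lemma sign_sum_tail (J : finType) (W : J -> {RV P >-> R}) (m b : J -> R) (l u : R) :
  (forall j w, W j w = 1 \/ W j w = -1) ->
  (forall j, 'E_P[W j] = (m j)%:E)%E ->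
  mutually_independent W -> 0 <= l -> (forall j, l * `|b j| <= 1 / 4) ->
  measurable [set w | u < \sum_j b j * (W j w - m j)] /\
  (P [set w | (u < \sum_j b j * (W j w - m j))%R] <=
    (expR (2 * l ^+ 2 * (\sum_j b j ^+ 2) - l * u))%:E)%E.
Proof.
move=> W1 EW indep l0 lb.
have mE : measurable [set w | u < \sum_j b j * (W j w - m j)].
  rewrite -[X in measurable X]setTI.
  have mf : measurable_fun setT (fun w => \sum_j b j * (W j w - m j)).
    apply: measurable_sum => j; apply: measurable_realfun.measurable_funM => //.
    by apply: measurable_realfun.measurable_funB.
  rewrite (_ : [set w | _] = (fun w => \sum_j b j * (W j w - m j)) @^-1` `]u, +oo[%classic).
    exact: mf.
  by apply/seteqP; split => w /=; rewrite in_itv /= andbT.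
split=> //.
have law j : exists pq : R * R, [/\ P (W j @^-1` [set 1]) = (pq.1)%:E,
     P (W j @^-1` [set -1]) = (pq.2)%:E,
     0 <= pq.1, 0 <= pq.2 & pq.1 + pq.2 = 1 /\ m j = pq.1 - pq.2].
  by have [p [q H]] := sign_law (W1 j) (EW j); exists (p, q).
have [pq pqP] := choice law.
pose pr j (s : bool) := if s then (pq j).1 else (pq j).2.
have pr0 j s : 0 <= pr j s by have [_ _ ? ? _] := pqP j; case: s.
have prP j s : P (W j @^-1` [set sign_val s]) = (pr j s)%:E.
  by have [? ? _ _ _] := pqP j; case: s.
have mS (j : J) (s : bool) : measurable (W j @^-1` [set sign_val s]).
  by apply: measurable_funPTI.
have PA s : P (sign_pattern W s) = (\prod_j pr j (s j))%:E.
  rewrite /sign_pattern indep // -prodEFin (eq_bigl xpredT); last by move=> j; rewrite inE.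
  by apply: eq_bigr => j _; rewrite prP.
pose S (s : {ffun J -> bool}) := \sum_j b j * (sign_val (s j) - m j).
(* Only patterns whose sum exceeds [u] are kept; they cover the tail event. *)
pose A s := if u < S s then sign_pattern W s else set0.
have mA s : measurable (A s).
  rewrite /A; case: ifP => // _; apply: fin_bigcap_measurable => //.
apply: (@le_trans _ _ (\sum_s P (A s))%E).
  apply: union_bound => // w /= uw.
  exists [ffun j => W j w == 1]; rewrite /A.
  have sE j : sign_val ([ffun j => W j w == 1] j) = W j w.
    rewrite ffunE; case: (W1 j w) => ->; first by rewrite eqxx.
    by rewrite (_ : (-1 == 1 :> R) = false) //; apply/eqP; lra.
  have -> : S [ffun j => W j w == 1] = \sum_j b j * (W j w - m j).
    by apply: eq_bigr => j _; rewrite sE.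
  by rewrite uw => j _ /=; rewrite sE.
(* A kept pattern is weighted by [expR (l * (S s - u))], which is at least 1; the others contribute
   nonnegative terms. *)
apply: (@le_trans _ _ (\sum_(s : {ffun J -> bool}) (\prod_j (pr j (s j) *
    expR (l * b j * (sign_val (s j) - m j))) * expR (- (l * u)))%R%:E)%E).
  apply: lee_sum => s _; rewrite /A; case: ifP => [us|_]; last first.
    by rewrite measure0 lee_fin mulr_ge0 ?expR_ge0 // prodr_ge0 // => j _; rewrite mulr_ge0 ?expR_ge0.
  rewrite PA lee_fin big_split /= -expR_sum -mulrA -expRD.
  rewrite ler_peMr ?prodr_ge0 // -expR0 ler_expR.
  have -> : \sum_j l * b j * (sign_val (s j) - m j) = l * S s.
    by rewrite mulr_sumr; apply: eq_bigr => j _; rewrite mulrA.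
  by rewrite -mulrBr mulr_ge0 // subr_ge0 ltW.
rewrite sumEFin lee_fin -mulr_suml expRD expRN ler_wpM2r ?invr_ge0 ?expR_ge0 //.
(* Distributivity turns the sum over patterns into a product over [j] of two-term moment generating
   functions. *)
rewrite -(bigA_distr_bigA (fun j s => pr j s * expR (l * b j * (sign_val s - m j)))).
rewrite mulr_sumr expR_sum.
apply: ler_prod => j _.
rewrite big_bool /= /pr /=; have [_ _ p0 q0 [pq1 ->]] := pqP j.
rewrite addr_ge0 ?mulr_ge0 ?expR_ge0 //=.
have -> : 2 * l ^+ 2 * b j ^+ 2 = 2 * (l * b j) ^+ 2 by ring.
by apply: sign_mgf_le => //; rewrite normrM ger0_norm.
Qed.
End Probability.

(** * The exponential series at imaginary arguments *)

Section Exponential.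
Variable R : realType.

(** The parts have the shape of the numerators in [cos_coeff] and [sin_coeff]. *)
Lemma imag_expr (y : R) (k : nat) : (0 +i* y) ^+ k =
  ((~~ odd k)%:R * (-1) ^+ k./2 * y ^+ k) +i* ((odd k)%:R * (-1) ^+ k.-1./2 * y ^+ k)
    :> R[i].
Proof.
have sq : (0 +i* y : R[i]) ^+ 2 = (- y ^+ 2)%:C.
  by rewrite expr2; simpc; rewrite expr2.
have even j : (0 +i* y : R[i]) ^+ j.*2 = ((-1) ^+ j * y ^+ j.*2)%:C.
  by rewrite -mul2n !exprM sq -rmorphXn /= [(- y ^+ 2) ^+ j]exprNn.
rewrite -(odd_double_half k); case: (odd k); rewrite ?add1n ?add0n /=.
  by rewrite exprS even odd_double /= ?doubleK; simpc; rewrite exprS; congr (_ +i* _); ring.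
by rewrite even odd_double /= doubleK !mul0r mul1r.
Qed.

Lemma exp_imag_series (y : R) (n : nat) :
  series (fun k => (k`!%:R)^-1 * (0 +i* y) ^+ k) n =
  (series (cos_coeff y) n) +i* (series (sin_coeff y) n) :> R[i].
Proof.
elim: n => [|n IHn]; first by rewrite /series /= !big_geq.
rewrite /series /= !big_nat_recr //= -[X in X + _]/(series _ n) IHn.
rewrite /cos_coeff /sin_coeff /= imag_expr.
have -> : (n`!%:R : R[i])^-1 = ((n`!%:R : R)^-1)%:C.
  by rewrite fmorphV rmorph_nat.
by simpc; congr (_ +i* _); rewrite [_^-1 * _]mulrC.
Qed.

Lemma cvg_exp_imag_series (y : R) :
  series (fun k => (k`!%:R)^-1 * (0 +i* y) ^+ k : (R[i] : numFieldType)) @ \oo -->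
    (cis y : (R[i] : numFieldType)).
Proof.
have hc : series (cos_coeff y) @ \oo --> cos y.
  by have := is_cvg_series_cos_coeff (x := y); rewrite cos.unlock.
have hs : series (sin_coeff y) @ \oo --> sin y.
  by have := is_cvg_series_sin_coeff (x := y); rewrite sin.unlock.
apply/cvgrPdist_lt => e e0.
(* A positive element of [R[i]] is real. *)
have [e' e'0 ->] : exists2 e' : R, 0 < e' & e = e'%:C.
  by case: e e0 => a b; rewrite ltcE /= => /andP[/eqP-> a0]; exists a.
have e2 : 0 < e' / 2 by rewrite divr_gt0.
move/cvgrPdist_lt : hc => /(_ _ e2) hc; move/cvgrPdist_lt : hs => /(_ _ e2) hs.
near=> n.
rewrite exp_imag_series; apply: (@le_lt_trans _ _ (normc (cis y -
  (series (cos_coeff y) n +i* series (sin_coeff y) n)))%:C); first by [].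
rewrite ltcR; apply: le_lt_trans (normc_ReIm _) _.
rewrite (splitr e') ltrD //=; near: n.
- exact: hc.
- exact: hs.
Unshelve. all: by end_near.
Qed.

End Exponential.

(** * Spectral expansion of the signal *)

Section Spectral.
Variables (R : realType) (M : nat).
Variables (H : 'M[R[i]]_M.+1) (psis : 'I_M.+1 -> 'cV[R[i]]_M.+1)
  (lambda : 'I_M.+1 -> R).
Hypothesis ortho : orthonormal_family psis.
Hypothesis eig : forall m, H *m psis m = (lambda m)%:C *: psis m.

(** The matrix with columns [psis m] is square, so its left inverse is also a right inverse. *)
Lemma resolution_identity : \sum_m (psis m *m (psis m)^t*) = 1%:M.
Proof.
pose U : 'M[R[i]]_M.+1 := \matrix_(i, m) psis m i ord0.
have UU : U^t* *m U = 1%:M.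
  apply/matrixP => a b; rewrite !mxE -[RHS](ortho a b) /braket !mxE.
  by apply: eq_bigr => j _; rewrite !mxE.
rewrite -(mulmx1C UU); apply/matrixP => i j; rewrite summxE !mxE.
by apply: eq_bigr => m _; rewrite !mxE big_ord1 !mxE.
Qed.

(** Powers of [A] are diagonal in the eigenprojectors, so each partial sum is a combination of
    projectors whose coefficients are partial sums of scalar exponentials. *)
Lemma expmx_eigenbasis (t : R) : expmx ((0 -i* t) *: H) =
  \sum_m cis (- (lambda m * t)) *: (psis m *m (psis m)^t*).
Proof.
pose A := (0 -i* t) *: H.
have Apsi m : A *m psis m = (0 +i* (- (lambda m * t))) *: psis m.
  by rewrite -scalemxAl eig scalerA; congr (_ *: _); simpc; rewrite mulrC.
have Ak k : A ^+ k = \sum_m (0 +i* (- (lambda m * t))) ^+ k *: (psis m *m (psis m)^t*).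
  elim: k => [|k IHk].
    by rewrite expr0 -[LHS]/(1%:M) -resolution_identity; apply: eq_bigr => m _; rewrite scale1r.
  rewrite exprS IHk -[LHS]/(A *m _) mulmx_sumr; apply: eq_bigr => m _.
  by rewrite -scalemxAr mulmxA Apsi -scalemxAl scalerA -exprSr.
have sE : series (fun k => (k`!%:R)^-1 *: A ^+ k) = fun n =>
   \sum_m series (fun k => (k`!%:R)^-1 * (0 +i* (- (lambda m * t))) ^+ k) n
      *: (psis m *m (psis m)^t*).
  apply/funext => n; rewrite /series /=.
  under eq_bigr do rewrite Ak scaler_sumr.
  rewrite exchange_big; apply: eq_bigr => m _; rewrite scaler_suml.
  by apply: eq_bigr => k _; rewrite scalerA.
rewrite /expmx -/A sE; apply: cvg_lim; first exact: norm_hausdorff.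
apply: cvg_big => [|m _]; first exact: add_continuous.
by apply: cvgZr_tmp; exact: cvg_exp_imag_series.
Qed.

Lemma braket_projector (psi : 'cV[R[i]]_M.+1) m :
  braket psi (psis m *m (psis m)^t* *m psi) = (normc (braket (psis m) psi) ^+ 2)%:C.
Proof.
have -> : braket psi (psis m *m (psis m)^t* *m psi) =
    braket psi (psis m) * braket (psis m) psi.
  by rewrite /braket -mulmxA (mulmxA _ (psis m)) mxE big_ord1.
have -> : braket psi (psis m) = Num.conj (braket (psis m) psi).
  rewrite /braket !mxE rmorph_sum; apply: eq_bigr => j _.
  by rewrite !mxE rmorphM /= conjCK mulrC.
by rewrite mulrC -normCK rmorphXn.
Qed.

Lemma signal_eigenbasis (psi : 'cV[R[i]]_M.+1) (t : R) : signal H psi t =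
  \sum_m cis (- (lambda m * t)) * (normc (braket (psis m) psi) ^+ 2)%:C.
Proof.
rewrite /signal expmx_eigenbasis {1}/braket mulmx_suml mulmx_sumr summxE.
apply: eq_bigr => m _; rewrite -scalemxAl -scalemxAr mxE; congr (_ * _).
exact: braket_projector.
Qed.

Lemma sum_overlaps (psi : 'cV[R[i]]_M.+1) : braket psi psi = 1 ->
  \sum_m normc (braket (psis m) psi) ^+ 2 = 1.
Proof.
move=> psi1; apply: complexI; rewrite rmorph_sum /= -[RHS]psi1.
rewrite -[X in _ = braket _ X]mul1mx -resolution_identity mulmx_suml.
rewrite {2}/braket mulmx_sumr summxE; apply: eq_bigr => m _.
by rewrite -braket_projector.
Qed.

(** The other eigenvalues enter with phases of modulus 1 and total weight [1 - p0]. *)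
Lemma signal_dominant (psi : 'cV[R[i]]_M.+1) (t : R) : braket psi psi = 1 ->
  normc (signal H psi t - (normc (braket (psis ord0) psi) ^+ 2)%:C *
    cis (- (lambda ord0 * t))) <= 1 - normc (braket (psis ord0) psi) ^+ 2.
Proof.
move=> psi1; set p0 := normc _ ^+ 2; have := sum_overlaps psi1; rewrite (bigD1 ord0) //= -/p0 => sum1.
rewrite signal_eigenbasis (bigD1 ord0) //= -/p0 [p0%:C * _]mulrC addrAC subrr add0r.
apply: le_trans (normc_sum _ _ _) _; rewrite -sum1 addrAC subrr add0r.
apply: ler_sum => m _; rewrite normcM normc_cis mul1r normc_real.
by rewrite ger0_norm // sqr_ge0.
Qed.

Lemma overlap_le1 (psi : 'cV[R[i]]_M.+1) : braket psi psi = 1 ->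
  normc (braket (psis ord0) psi) ^+ 2 <= 1.
Proof.
move=> psi1; rewrite -(sum_overlaps psi1) (bigD1 ord0) //= lerDl.
by apply: sumr_ge0 => m _; exact: sqr_ge0.
Qed.
End Spectral.

(** * Application to the QCELS loss, and the sample size *)

Section Estimate.
Variable R : realType.

Lemma modsym_bound (a x : R) : 0 < a -> `|modsym a x| <= a.
Proof.
move=> a0; rewrite /modsym.
have /andP[h1 h2] := floor_itv ((x + a) / (2 * a)).
move: (Num.floor _) h1 h2 => f; rewrite intrD => h1 h2.
rewrite ler_pdivlMr ?mulr_gt0 // in h1; rewrite ltr_pdivrMr ?mulr_gt0 // in h2.
by rewrite ler_norml; lra.
Qed.

(** The reduction shifts [x] by a multiple of [2 * pi / tau], which is invisible at integer
    multiples of [tau]. *)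
Lemma cis_modsym (tau x : R) (n : nat) : 0 < tau ->
  cis (modsym (pi / tau) x * tau * n%:R) = cis (x * tau * n%:R).
Proof.
move=> t0; rewrite /modsym; move: (Num.floor _) => f.
have -> : x * tau * n%:R = (x - 2 * (pi / tau) * f%:~R) * tau * n%:R
    + 2 * pi * (f * n%:Z)%:~R.
  by rewrite intrM; move: (pi : R) => p; field; rewrite gt_eqF.
by rewrite [RHS]cisD cis2piz mulr1.
Qed.

(** Rotating every term by [cis (lam * (n%:R * tau))] preserves moduli, makes the target signal the
    constant [p0], and gives the fit frequency [- (y * tau)], of modulus at most [pi];
    [least_squares_core] then applies. *)
Lemma qcels_estimate (N : nat) (tau lam theta p0 delta B : R) (z : 'I_N -> R[i])
    (s : nat -> R[i]) (r : R[i]) :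
  (1 < N)%N -> 0 < tau -> 71 / 100 <= p0 -> 0 < delta <= 4 -> 0 <= B ->
  (forall n, (n < N)%N ->
    normc (s n - p0%:C * cis (- (lam * (n%:R * tau)))) <= 1 - p0) ->
  300 * (1 - p0) <= delta -> 400 * (100 * B) <= delta ->
  (forall k m, (k < N)%N -> (m <= N)%N ->
    normc (\sum_(n < N | (n < m)%N) (z n - s n) *
      cis (lam * (n%:R * tau) - grid_angle R N k * n%:R)) <= N%:R * B) ->
  qcels_loss tau z r theta <= qcels_loss tau z p0%:C lam ->
  N%:R * tau * `|modsym (pi / tau) (theta - lam)| < delta.
Proof.
move=> N1 t0 p071 d04 B0 hs hp hB hw hloss.
pose y := modsym (pi / tau) (theta - lam).
have pt0 : 0 < pi / tau :> R by rewrite divr_gt0 ?pi_gt0.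
have ybnd : `|- (y * tau)| <= pi.
  rewrite normrN normrM (gtr0_norm t0) -ler_pdivlMr //; exact: modsym_bound.
pose rot n : R[i] := cis (lam * (n%:R * tau)).
(* The noise is extended by 0 to indices from [N] on. *)
pose W n : R[i] := if insub n is Some i then z i - s n else 0.
have WE (n : 'I_N) : W n = z n - s n by rewrite /W valK.
(* The conjugate, since [least_squares_core] takes the noise as [(w n)^*]; hence the minus sign
   before the grid angle in [hw]. *)
pose w n := (W n * rot n)^*.
have -> : N%:R * tau * `|y| = N%:R * `|- (y * tau)|.
  by rewrite normrN normrM (gtr0_norm t0) [`|y| * tau]mulrC mulrA.
apply: (@least_squares_core R N (- (y * tau)) p0 (1 - p0) B delta r
  (fun n => s n * rot n - p0%:C) w) => //.
- move=> n nN; apply: le_trans (hs n nN).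
  rewrite -[leRHS]mulr1 -[X in _ <= _ * X](normc_cis (lam * (n%:R * tau))) -normcM mulrBl -mulrA.
  by rewrite cis_mulVl mulr1.
- move=> k m kN mN; apply: le_trans (hw k m kN mN).
  rewrite (big_ord_widen N (fun n => w n * cis (grid_angle R N k * n%:R))) //.
  rewrite -normc_conj rmorph_sum /= le_eqVlt; apply/orP; left; apply/eqP.
  congr normc; apply: eq_bigr => n _.
  by rewrite rmorphM /= /w conjCK -cisN -WE cisD mulrA.
move: hloss; rewrite /qcels_loss ler_pM2l ?invr_gt0 ?ltr0n ?(ltnW N1) //.
have e1 : \sum_(n < N) normc (z n - r * cis (- (theta * n%:R * tau))) ^+ 2 =
   \sum_(n < N) normc (s n * rot n - p0%:C + (w n)^* -
       (r * cis (- (y * tau) * n%:R) - p0%:C)) ^+ 2.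
  apply: eq_bigr => n _; congr (_ ^+ 2).
  rewrite -[LHS]mulr1 -[X in _ * X = _](normc_cis (lam * (n%:R * tau))) -normcM; congr normc.
  have -> : cis (- (y * tau) * n%:R) = cis (- (theta * n%:R * tau)) * rot n.
    rewrite mulNr [LHS]cisN /y cis_modsym // -cisN -cisD; congr cis; ring.
  by rewrite /w conjCK WE -/(rot n); ring.
have e2 : \sum_(n < N) normc (z n - p0%:C * cis (- (lam * n%:R * tau))) ^+ 2 =
   \sum_(n < N) normc (s n * rot n - p0%:C + (w n)^*) ^+ 2.
  apply: eq_bigr => n _; congr (_ ^+ 2).
  rewrite -[LHS]mulr1 -[X in _ * X = _](normc_cis (lam * (n%:R * tau))) -normcM; congr normc.
  rewrite mulrBl -[lam * _ * _]mulrA -[p0%:C * _ * _]mulrA cis_mulVl.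
  by rewrite /w conjCK WE -/(rot n); ring.
by rewrite e1 e2.
Qed.

(** With [A] the product [N%:R * Ns%:R], half of the exponent pays for [4] and [eta] ([b1]), the
    other half for [N%:R ^+ 2], which is at most [A ^+ 2] ([b2]). *)
Lemma sample_complexity (zeta c0 : R) : 0 < zeta -> zeta < 1 -> 0 < c0 -> c0 <= 1 ->
  exists2 C : R, 0 < C & forall (N Ns : nat) (delta eta : R),
    (0 < N)%N -> (0 < Ns)%N -> 0 < delta <= 4 -> 0 < eta < 1 / 2 ->
    C * delta `^ (- (2 + zeta)) * polylog 1 [:: ln zeta^-1; eta^-1]
      <= N%:R * Ns%:R ->
    4 * N%:R ^+ 2 * expR (- (c0 * delta ^+ 2 * (N%:R * Ns%:R))) <= eta.
Proof.
(* A lower bound on [A] of order [delta]^ (- (2 + zeta))[makes]delta ^+ 2 * A[at least of order]A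
   [^ g]: the extra [zeta] buys a positive power of [A]. *)
move=> z0 z1 c00 c01; pose g := zeta / (2 + zeta).
have z20 : 0 < 2 + zeta by lra.
have g0 : 0 < g by rewrite divr_gt0.
have g1 : g <= 1 by rewrite ler_pdivrMr //; lra.
(* Chosen so that [2 * ln A] is [c0 / 2] times [c * (g * ln A)] in [b2]. *)
pose c := 4 / (c0 * g).
have c_gt0 : 0 < c by rewrite divr_gt0 // mulr_gt0.
have cE : c0 * g * c = 4 by rewrite /c mulrC divfK // gt_eqF // mulr_gt0.
have cE' : 4 <= c0 * c.
  by rewrite -cE -mulrA ler_wpM2l ?(ltW c00) // ler_piMl // ltW.
exists (expR (2 * c)); first exact: expR_gt0.
move=> N Ns delta eta N0 Ns0 /andP[d0 d4] /andP[e0 e1].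
rewrite /polylog expr1 !big_cons big_nil addr0 => hA.
set A := N%:R * Ns%:R in hA *.
pose L := ln eta^-1.
have L0 : 0 <= L by rewrite ln_ge0 // invf_ge1 //; lra.
have NA : N%:R <= A by rewrite ler_peMr // ler1n.
have N1 : 1 <= N%:R :> R by rewrite ler1n.
have A0 : 0 < A by lra.
have pw0 : 0 < expR (2 * c) * delta `^ (- (2 + zeta)).
  by rewrite mulr_gt0 ?expR_gt0 // powR_gt0.
have hA' : expR (2 * c) * delta `^ (- (2 + zeta)) * (2 + L) <= A.
  apply: le_trans hA; apply: ler_wpM2l; first exact: ltW.
  by rewrite lerD2l [`|ln eta^-1|]ger0_norm // lerDr.
have pE : delta `^ (- (2 + zeta)) = expR (- (2 + zeta) * ln delta).
  by rewrite /powR gt_eqF.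
have dE : delta ^+ 2 = expR (2 * ln delta).
  by rewrite expRM_natl lnK.
have AE : A = expR (ln A) by rewrite lnK.
rewrite pE -expRD in hA' pw0.
have ln2 : ln 2 <= 1 :> R.
  by apply: (@le_ln1Dx R 1); lra.
have ln4 : ln 4 <= 2 :> R.
  have -> : (4 : R) = 2 ^+ 2 by ring.
  by rewrite lnXn // mulr2n; lra.
have b1 : 2 + L <= c0 / 2 * delta ^+ 2 * A.
  have : c0 / 2 * delta ^+ 2 * (expR (2 * c + - (2 + zeta) * ln delta) * (2 + L))
      <= c0 / 2 * delta ^+ 2 * A.
    by rewrite ler_wpM2l // mulr_ge0 ?sqr_ge0 // ltW // divr_gt0 //.
  apply: le_trans; rewrite mulrA; apply: ler_peMl; first by lra.
  have -> : c0 / 2 * delta ^+ 2 * expR (2 * c + - (2 + zeta) * ln delta) =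
      c0 / 2 * expR (2 * c - zeta * ln delta).
    by rewrite dE -mulrA -expRD; congr (_ * expR _); ring.
  have ld : ln delta <= 2 by apply: le_trans ln4; rewrite ler_ln ?posrE //; lra.
  have : 1 + (2 * c - zeta * ln delta) <= expR (2 * c - zeta * ln delta).
    exact: expR_ge1Dx.
  have zld : zeta * ln delta <= 2 by nra.
  have c4 : 4 <= c0 * c := cE'.
  have c02 : 0 < c0 / 2 by rewrite divr_gt0.
  move=> h; have := ler_wpM2l (ltW c02) h.
  have : 0 <= c0 * (2 - zeta * ln delta) by rewrite mulr_ge0 ?(ltW c00) //; lra.
  lra.
have b2 : 2 * ln A <= c0 / 2 * delta ^+ 2 * A.
  have lnA : 2 * c - (2 + zeta) * ln delta <= ln A.
    rewrite -ler_expR -AE; apply: le_trans hA'.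
    by rewrite mulNr ler_peMr ?expR_ge0 //; lra.
  have h : c + g * ln A <= 2 * ln delta + ln A.
    rewrite -(ler_pM2l z20).
    have -> : (2 + zeta) * (c + g * ln A) = (2 + zeta) * c + zeta * ln A.
      by rewrite mulrDr mulrA [_ * g]mulrC /g divfK // gt_eqF.
    have : zeta * c <= c by rewrite ler_piMl // ltW.
    lra.
  have lnA0 : 0 <= ln A by rewrite ln_ge0 //; lra.
  have cc : c * (g * ln A) <= delta ^+ 2 * A.
    have -> : delta ^+ 2 * A = expR (2 * ln delta + ln A) by rewrite expRD -dE -AE.
    apply: (@le_trans _ _ (expR (c + g * ln A))).
      have ec := expR_ge1Dx c; have eg := expR_ge1Dx (g * ln A).
      rewrite expRD; apply: ler_pM; [exact: ltW | by rewrite mulr_ge0 // ltW | lra | lra].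
    by rewrite ler_expR.
  have -> : 2 * ln A = c0 / 2 * (c * (g * ln A)).
    by rewrite -[2 in LHS](_ : c0 * g * c / 2 = 2); [ring | rewrite cE; lra].
  by rewrite -[leRHS]mulrA; apply: ler_wpM2l => //; rewrite divr_ge0 // ltW.
have NE : 4 * N%:R ^+ 2 = expR (ln 4 + 2 * ln N%:R) :> R.
  by rewrite expRD lnK ?posrE // expRM_natl lnK ?posrE //; lra.
rewrite NE -expRD -[leRHS]lnK ?posrE // ler_expR.
have lnN : ln N%:R <= ln A by rewrite ler_ln ?posrE //; lra.
have : ln eta = - L by rewrite /L lnV ?posrE // opprK.
lra.
Qed.
End Estimate.

(** * Tail bound for the modulated partial sums of the noise *)

Section Noise.
Variables (R : realType) (d : measure_display) (T : measurableType d)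
  (P : probability T R).

Lemma measurable_modsym (a lam c : R) (X : {RV P >-> R}) : 0 < a ->
  measurable [set w | `|modsym a (X w - lam)| < c].
Proof.
move=> a0.
have mfl : measurable_fun setT (fun y : R => (Num.floor y)%:~R : R).
  apply: measurable_realfun.nondecreasing_measurable => // x y xy.
  by rewrite ler_int; exact: le_floor.
have mf : measurable_fun setT (fun w => modsym a (X w - lam)).
  have mX : measurable_fun setT (fun w => X w - lam).
    exact: measurable_realfun.measurable_funB.
  apply: measurable_realfun.measurable_funB => //.
  apply: measurable_realfun.measurable_funM => //.
  apply: (measurableT_comp mfl).
  apply: measurable_realfun.measurable_funM => //.
  exact: measurable_realfun.measurable_funD.
rewrite (_ : [set w | _] = (fun w => modsym a (X w - lam)) @^-1` `]-c, c[%classic).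
  by rewrite -[X in measurable X]setTI; exact: mf.
by apply/seteqP; split => w /=; rewrite in_itv /= ltr_norml.
Qed.

Variables (N Ns : nat) (X Y : 'I_Ns -> 'I_N -> {RV P >-> R}) (s : nat -> R[i])
  (alpha : nat -> nat -> R).
Hypotheses (Ns0 : (0 < Ns)%N).

Definition noise (k m : nat) (w : T) : R[i] :=
  \sum_(n < N | (n < m)%N) (hadamard_average X Y w n - s n) * cis (alpha k n).

(** Both kinds of outcomes form one family of signs, so that a single tail bound covers them. *)
Let J : finType := ('I_Ns * 'I_N + 'I_Ns * 'I_N)%type.
Let W (j : J) : {RV P >-> R} :=
  match j with inl kn => X kn.1 kn.2 | inr kn => Y kn.1 kn.2 end.
Let mean (j : J) : R :=
  match j with inl kn => complex.Re (s kn.2) | inr kn => complex.Im (s kn.2) end.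

Definition re_im (b : bool) (z : R[i]) := if b then complex.Re z else complex.Im z.

(** The entries of the rotation by [alpha k n], divided by [Ns] and cut off at [m]: the coefficients
    of the outcomes in the real or imaginary part of [noise]. *)
Definition noise_weight (b : bool) (k m : nat) (j : J) : R :=
  match j with
  | inl kn => (kn.2 < m)%:R * (Ns%:R^-1 *
      if b then cos (alpha k kn.2) else sin (alpha k kn.2))
  | inr kn => (kn.2 < m)%:R * (Ns%:R^-1 *
      if b then - sin (alpha k kn.2) else cos (alpha k kn.2))
  end.

Lemma re_im_sum b (I : Type) (r : seq I) (Q : pred I) (f : I -> R[i]) :
  re_im b (\sum_(i <- r | Q i) f i) = \sum_(i <- r | Q i) re_im b (f i).
Proof.
elim/big_rec2: _ => [|i y z _ <-]; first by case: b.
by case: (f i); case: z; case: b.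
Qed.

Lemma re_im_term b w (n : 'I_N) k :
  re_im b ((hadamard_average X Y w n - s n) * cis (alpha k n)) =
  \sum_(i < Ns) Ns%:R^-1 *
    ((X i n w - complex.Re (s n)) * (if b then cos (alpha k n) else sin (alpha k n)) +
     (Y i n w - complex.Im (s n)) * (if b then - sin (alpha k n) else cos (alpha k n))).
Proof.
have NsU : (Ns%:R : R[i]) != 0 by rewrite pnatr_eq0 -lt0n.
have sE : s n = Ns%:R^-1 * \sum_(i < Ns) s n.
  by rewrite sumr_const card_ord -[s n *+ Ns]mulr_natl mulKf.
rewrite /hadamard_average [X in re_im b ((_ - X) * _)]sE -mulrBr -sumrB mulr_sumr mulr_suml.
rewrite re_im_sum; apply: eq_bigr => i _.
have -> : (Ns%:R : R[i])^-1 = ((Ns%:R : R)^-1)%:C by rewrite fmorphV rmorph_nat.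
by case: (s n) => x y; case: b; rewrite /re_im /cis; simpc => /=; ring.
Qed.

Lemma re_im_noise b k m w : re_im b (noise k m w) =
  \sum_(j : J) noise_weight b k m j * (W j w - mean j).
Proof.
rewrite /noise re_im_sum big_mkcond big_sumType /=.
rewrite -(pair_bigA _ (fun (i : 'I_Ns) (n : 'I_N) => (n < m)%:R * (Ns%:R^-1 *
      if b then cos (alpha k n) else sin (alpha k n)) * (X i n w - complex.Re (s n)))).
rewrite -(pair_bigA _ (fun (i : 'I_Ns) (n : 'I_N) => (n < m)%:R * (Ns%:R^-1 *
      if b then - sin (alpha k n) else cos (alpha k n)) * (Y i n w - complex.Im (s n)))).
rewrite -big_split /=.
under [RHS]eq_bigr do rewrite -big_split /=.
rewrite [RHS]exchange_big /=; apply: eq_bigr => n _.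
rewrite re_im_term; case: (n < m)%N; last by rewrite big1 // => i _; rewrite !mul0r addr0.
by apply: eq_bigr => i _; rewrite !mul1r mulrDr !mulrA; congr (_ + _); exact: mulrAC.
Qed.

Lemma noise_weight_le b k m j : `|noise_weight b k m j| <= Ns%:R^-1.
Proof.
have H (c : bool) (t : R) : `|t| <= 1 -> `|c%:R * (Ns%:R^-1 * t)| <= Ns%:R^-1.
  move=> t1; rewrite !normrM [`|Ns%:R^-1|]ger0_norm // [`|c%:R|]ger0_norm ?ler0n //.
  rewrite mulrCA ler_piMr // mulr_ile1 //; by case: c.
case: j => -[i n] /=; apply: H; case: b; rewrite ?normrN ?cos_max ?sin_max //.
Qed.

Hypotheses (X1 : forall k n w, X k n w = 1 \/ X k n w = -1)
  (Y1 : forall k n w, Y k n w = 1 \/ Y k n w = -1)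
  (EX : forall k n, ('E_P[X k n] = (complex.Re (s n))%:E)%E)
  (EY : forall k n, ('E_P[Y k n] = (complex.Im (s n))%:E)%E)
  (indep : mutually_independent W).

Lemma noise_deviation (kap delta : R) (E : set T) :
  (0 < N)%N -> 0 < kap <= 1 -> 0 < delta <= 4 -> measurable E ->
  (forall w, (forall k m, (k < N)%N -> (m <= N)%N ->
     normc (noise k m w) <= N%:R * (kap * delta)) -> E w) ->
  ((1 - 4 * N%:R ^+ 2 * expR (- (kap ^+ 2 / 64 * delta ^+ 2 * (N%:R * Ns%:R))))%R%:E
    <= P E)%E.
Proof.
move=> N0 /andP[k0 k1] /andP[d0 d4] mE good.
have N0R : 0 < N%:R :> R by rewrite ltr0n.
have Ns0R : 0 < Ns%:R :> R by rewrite ltr0n.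
have kd0 : 0 < kap * delta by rewrite mulr_gt0.
pose q := expR (- (kap ^+ 2 / 64 * delta ^+ 2 * (N%:R * Ns%:R))).
(* Half of the allowed modulus, since [normc] is at most the sum of the absolute real and imaginary
   parts. *)
pose u := N%:R * (kap * delta) / 2.
(* The minimizer of [4 * l ^+ 2 * N%:R / Ns%:R - l * u]; as [kap * delta] is at most 4, [l / Ns%:R]
   is at most 1/4. *)
pose l := kap * delta * Ns%:R / 16.
have l0 : 0 <= l by rewrite divr_ge0 // mulr_ge0 // ltW.
(* Frequency, cutoff minus one, real or imaginary part, and sign: [4 * N ^ 2] events. The cutoff 0
   gives an empty sum and is treated separately. *)
pose I : finType := ('I_N * 'I_N * bool * bool)%type.
pose b (e : I) (j : J) := (-1) ^+ e.2 * noise_weight e.1.2 e.1.1.1 e.1.1.2.+1 j.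
have nb e j : `|b e j| <= Ns%:R^-1.
  by rewrite normrM normrX normrN normr1 expr1n mul1r noise_weight_le.
pose bad (e : I) := [set w | u < \sum_j b e j * (W j w - mean j)].
have W1 j w : W j w = 1 \/ W j w = -1 by case: j => -[i n] /=.
have EW j : ('E_P[W j] = (mean j)%:E)%E by case: j => -[i n] /=.
have lb e j : l * `|b e j| <= 1 / 4.
  apply: (@le_trans _ _ (l * Ns%:R^-1)); first by rewrite ler_wpM2l.
  rewrite /l mulrAC mulfK ?gt_eqF //; nra.
have tail e : measurable (bad e) /\ (P (bad e) <= q%:E)%E.
  have [mb hb] := sign_sum_tail u W1 EW indep l0 (lb e).
  split => //; apply: le_trans hb _; rewrite lee_fin ler_expR.
  have sb : \sum_j b e j ^+ 2 <= 2 * (N%:R / Ns%:R).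
    apply: (@le_trans _ _ (\sum_(j : J) Ns%:R^-1 ^+ 2)).
      apply: ler_sum => j _; rewrite -(real_normK (num_real (b e j))).
      by apply: lerXn2r; rewrite ?nnegrE ?invr_ge0.
    have cJ : #|J| = (2 * (Ns * N))%N.
      by rewrite card_sum !card_prod !card_ord mul2n addnn.
    rewrite sumr_const cJ -[leLHS]mulr_natl !natrM.
    by rewrite le_eqVlt; apply/orP; left; apply/eqP; field; rewrite gt_eqF.
  have := ler_wpM2l (mulr_ge0 (ler0n R 2) (sqr_ge0 l)) sb.
  have -> : 2 * l ^+ 2 * (2 * (N%:R / Ns%:R)) =
      kap ^+ 2 / 64 * delta ^+ 2 * (N%:R * Ns%:R).
    by rewrite /l; field; rewrite gt_eqF.
  have : l * u = 2 * (kap ^+ 2 / 64 * delta ^+ 2 * (N%:R * Ns%:R)).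
    by rewrite /l /u; field.
  lra.
have bound : (P (~` E) <= (4 * N%:R ^+ 2 * q)%:E)%E.
  apply: (@le_trans _ _ (\sum_(e : I) P (bad e))%E).
    apply: union_bound; [exact: measurableC | by move=> e; case: (tail e)|].
    move=> w nEw; apply: contrapT => nbad; apply: nEw; apply: good => k [|m] kN mN.
      by rewrite /noise big_pred0 // normc0 mulr_ge0 // ltW.
    have pu c : `|re_im c (noise k m.+1 w)| <= u.
      have ub (c' : bool) : (-1) ^+ c' * re_im c (noise k m.+1 w) <= u.
        rewrite leNgt; apply/negP => H; apply: nbad.
        exists (Ordinal kN, Ordinal mN, c, c'); rewrite /bad /=.
        move: H; rewrite re_im_noise mulr_sumr; congr (_ < _).
        by apply: eq_bigr => j _; rewrite /b /= mulrA.
      by have := ub true; have := ub false; rewrite expr0 expr1 ler_norml; lra.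
    have := normc_ReIm (noise k m.+1 w).
    by have := pu true; have := pu false; rewrite /re_im /u; lra.
  apply: (@le_trans _ _ (\sum_(e : I) q%:E)%E).
    by apply: lee_sum => e _; case: (tail e).
  rewrite sumEFin lee_fin sumr_const !card_prod card_bool !card_ord -[leLHS]mulr_natl !natrM.
  by rewrite le_eqVlt; apply/orP; left; apply/eqP; ring.
have fE : P E \is a fin_num by apply: fin_num_measure.
move: bound; rewrite probability_setC //.
move: fE; case: (P E) => // r _; rewrite -EFinB !lee_fin -/q; lra.
Qed.

End Noise.

(** * Choice of the constants and conclusion *)

Theorem theorem7 (R : realType) :
  exists zeta0 : R, 0 < zeta0 /\
  forall zeta : R, 0 < zeta -> zeta < zeta0 ->
  exists c1 : R, 0 < c1 /\
  forall c2 : R, c1 <= c2 ->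
  exists (C C' : R) (k k' : nat), 0 < C /\ 0 < C' /\
  forall (M : nat) (H : 'M[R[i]]_M.+1)
    (psis : 'I_M.+1 -> 'cV[R[i]]_M.+1) (lambda : 'I_M.+1 -> R)
    (psi : 'cV[R[i]]_M.+1)
    (N Ns : nat) (tau T delta eta eps : R)
    (d : measure_display) (Omega : measurableType d) (P : probability Omega R)
    (X Y : 'I_Ns -> 'I_N -> {RV P >-> R})
    (rstar : Omega -> R[i]) (thetastar : {RV P >-> R}),
  H \is hermsymmx ->
  orthonormal_family psis ->
  (forall m, H *m psis m = (lambda m)%:C *: psis m) ->
  - pi <= lambda ord0 < pi ->
  braket psi psi = 1 ->
  (0 < N)%N -> (0 < Ns)%N -> 0 < tau ->
  (forall k n w, X k n w = 1 \/ X k n w = -1) ->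
  (forall k n w, Y k n w = 1 \/ Y k n w = -1) ->
  (forall k n,
     ('E_P[X k n] = (complex.Re (signal H psi (n%:R * tau)))%:E)%E) ->
  (forall k n,
     ('E_P[Y k n] = (complex.Im (signal H psi (n%:R * tau)))%:E)%E) ->
  mutually_independent
    (fun j : 'I_Ns * 'I_N + 'I_Ns * 'I_N =>
       match j with inl kn => X kn.1 kn.2 | inr kn => Y kn.1 kn.2 end) ->
  (forall w, qcels_minimizer tau (hadamard_average X Y w)
               (rstar w) (thetastar w)) ->
  T = N%:R * tau ->
  let p0 : R := normc (braket (psis ord0) psi) ^+ 2 in
  71 / 100 < p0 ->
  0 < delta <= 4 -> 0 < eta < 1 / 2 -> 0 < eps ->
  c1 * Num.sqrt (1 - p0) <= delta <= c2 * Num.sqrt (1 - p0) ->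
  C * delta `^ (- (2 + zeta)) * polylog k [:: ln zeta^-1; eta^-1]
    <= N%:R * Ns%:R ->
  C' * polylog k' [:: eta^-1] <= (minn N Ns)%:R ->
  T = delta / eps ->
  ((1 - eta)%R%:E <=
     P [set w | (`|modsym (pi / tau) (thetastar w - lambda ord0)|
                   < delta / T)%R])%E.
Proof.
exists 1; split => // zeta z0 z1.
(* As [1 - p0] is at most its square root, this gives [300 * (1 - p0) <= delta], which
   [qcels_estimate] asks for. *)
exists 300; split => // c2 _.
(* The noise level [B = kap * delta] satisfies [400 * (100 * B) <= delta] with equality. *)
have [kap [kap0 kap1 kapE]] : exists kap : R, [/\ 0 < kap, kap <= 1 & 400 * (100 * kap) = 1].
  by exists (400^-1 / 100); split; lra.
have c00 : 0 < kap ^+ 2 / 64 by rewrite divr_gt0 // exprn_gt0.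
have c01 : kap ^+ 2 / 64 <= 1.
  by rewrite ler_pdivrMr // (le_trans (exprn_ile1 _ (ltW kap0) kap1)) //; lra.
have [C C0 hC] := sample_complexity z0 z1 c00 c01.
(* A power 0 makes the second [polylog] equal to 1, so the constant 2 yields [1 < N]. *)
exists C, 2, 1%N, 0%N; split => //; split => //.
move=> M H psis lambda psi N Ns tau T delta eta eps d Omega P X Y rstar thetastar.
move=> _ ortho eig _ psi1 N0 Ns0 t0 X1 Y1 EX EY indep hmin TE p0 p071 d04 eta01 eps0.
case/andP=> hd _ hA hN TE'.
have N1 : (1 < N)%N.
  move: hN; rewrite /polylog expr0 mulr1 ler_nat => hN.
  by apply: leq_trans hN _; exact: geq_minl.
have d0 : 0 < delta by case/andP: d04.
have T0 : 0 < T by rewrite TE mulr_gt0 // ltr0n.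
have p01 : p0 <= 1 := overlap_le1 ortho psi1.
have hp : 300 * (1 - p0) <= delta.
  apply: le_trans hd; rewrite ler_wpM2l //.
  have q0 : 0 <= 1 - p0 by rewrite subr_ge0.
  rewrite -[leLHS]sqr_sqrtr // expr2 ler_piMl ?sqrtr_ge0 //.
  by rewrite -[leRHS]sqrtr1 ler_sqrt //; lra.
pose s n := signal H psi (n%:R * tau).
pose alpha k n : R := lambda ord0 * (n%:R * tau) - grid_angle R N k * n%:R.
have pt0 : 0 < pi / tau :> R by rewrite divr_gt0 ?pi_gt0.
have mE := measurable_modsym (lambda ord0) (delta / T) thetastar pt0.
have k01 : 0 < kap <= 1 by rewrite kap0.
have dev := noise_deviation (s := s) (alpha := alpha) Ns0 X1 Y1 EX EY indep N0 k01 d04 mE.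
apply: le_trans (dev _).
  by rewrite lee_fin lerD2l lerN2 hC.
move=> w hw /=; rewrite ltr_pdivlMr // mulrC TE.
apply: (qcels_estimate (p0 := p0) (s := s) (z := hadamard_average X Y w)
  (r := rstar w) N1 t0 (ltW p071) d04 (mulr_ge0 (ltW kap0) (ltW d0)) _ hp _ hw (hmin w _ _)).
- move=> n _; exact: signal_dominant.
- by rewrite [100 * _]mulrA [400 * _]mulrA kapE mul1r.
Qed.
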